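(* Let $(X,\mathcal{A},\mu)$ be a charge space and let $f : X \rightarrow \mathbb{R}$ be a function. Then the following three statements are logically equivalent. 1. $f \in L_1(X,\mathcal{A},\mu)$. 2. $f$ satisfies the following: (a) there exists a countable set $C \subset \mathbb{R}$ such that $f^{-1}(y,\infty) \in \overline{\mathcal{A}}$ for all $y \in \mathbb{R} \setminus C$; and (b) for all $\epsilon > 0$, there exists $y \in (0, \infty)$ such that $| f | I_{| f |^{-1}(y, \infty)} \in L_1(X,\mathcal{A},\mu)$ with $\int | f | I_{| f |^{-1}(y, \infty)} \, d\mu < \epsilon$. 3. $f \in L_0(X,\mathcal{A},\mu)$ and there exist sequences $\{ f^+_n \}_{n=1}^{\infty}$ and $\{ f^-_n \}_{n=1}^{\infty}$ of simple functions with respect to $\overline{\mathcal{A}}$ of the form \[ f^+_n = \sum_{j=1}^{K_n-1} y_{n,j} I_{(f^+)^{-1}(y_{n,j},y_{n,j+1}]} + y_n I_{(f^+)^{-1}(y_n,\infty)}, \qquad f^-_n = \sum_{j=1}^{K_n-1} y_{n,j} I_{(f^-)^{-1}(y_{n,j},y_{n,j+1}]} + y_n I_{(f^-)^{-1}(y_n,\infty)}, \] where (i) $K_n := n2^n$; (ii) $y_{n,j} \in ((j-1)2^{-n}, j2^{-n}]$ for each $n \in \mathbb{N}$ and $j \in \{ 1, \ldots, K_n \}$, with $y_n := y_{n,K_n}$; (iii) $(f^+)^{-1}(y_{n,j},\infty) \in \overline{\mathcal{A}}$ and $(f^-)^{-1}(y_{n,j},\infty) \in \overline{\mathcal{A}}$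 for all $n$ and $j\in\{1,\ldots,K_n\}$; (iv) $\{ y_{n,j} \}_{j=1}^{K_n} \subset \{ y_{n+1,j} \}_{j=1}^{K_{n+1}}$ for each $n$; (v) $f^+_n \to f^+$ and $f^-_n \to f^-$ hazily (with respect to $\mathcal{A}$) as $n \rightarrow \infty$; and which satisfy in addition $\int | f^+_m - f^+_n | \, d\mu \rightarrow 0$ and $\int | f^-_m - f^-_n | \, d\mu \rightarrow 0$ as $m, n \rightarrow \infty$.
   Context: A field $\mathcal{A}$ of subsets of a set $X$ is a collection containing $\emptyset$ and closed under complements and finite unions. A charge $\mu$ on $\mathcal{A}$ is a function $\mu:\mathcal{A}\to[0,\infty)$ with $\mu(\emptyset)=0$ and $\mu(A\cup B)=\mu(A)+\mu(B)$ for disjoint $A,B\in\mathcal{A}$ (all charges are non-negative and bounded, $\mu(X)<\infty$). Then $(X,\mathcal{A},\mu)$ is a charge space. Outer charge: $\mu^*(A):=\inf\{\mu(B): B\in\mathcal{A}, A\subseteq B\}$ for $A\subseteq X$. A sequence $f_n:X\to\mathbb{R}$ converges hazily to $f$ (with respect to $\mathcal{A}$) if for every $\epsilon>0$, $\mu^*(\{x:|f_n(x)-f(x)|>\epsilon\})\to 0$. A simple function (with respect to a field) is $\sum_{k=1}^K c_kI_{A_k}$ with $c_k\in\mathbb{R}$ and $\{A_1,\dots,A_K\}$ a finite partition of $X$ into sets of that field; its integral is $\sum_k c_k\mu(A_k)$. $f:X\to\mathbb{R}$ is $T_1$-measurable if some sequence of simple functions (with respect to $\mathcal{A}$) converges hazily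 to $f$; $L_0(X,\mathcal{A},\mu)$ is the set of $T_1$-measurable functions. $f$ is integrable if there are simple functions $f_n\to f$ hazily with $\int|f_n-f_m|d\mu\to0$ as $n,m\to\infty$, and then $\int f d\mu:=\lim_n\int f_n d\mu$ (well defined). $L_1(X,\mathcal{A},\mu)$ is the set of integrable functions. The Peano-Jordan completion of $(X,\mathcal{A},\mu)$ is the charge space $(X,\overline{\mathcal{A}},\overline{\mu})$ with $\overline{\mathcal{A}}:=\{A\subseteq X:\forall\epsilon>0\ \exists B,C\in\mathcal{A}, B\subseteq A\subseteq C, \mu(C\setminus B)<\epsilon\}$ and $\overline{\mu}(A):=\inf\{\mu(C):A\subseteq C\in\mathcal{A}\}$. Simple functions with respect to $\overline{\mathcal{A}}$ are integrable with respect to $(X,\mathcal{A},\mu)$, with the same integral as with respect to $\overline{\mu}$. Notation: $f^+:=\max\{f,0\}$, $f^-:=\max\{-f,0\}$; $f^{-1}(a,b]$ is the inverse image of the interval $(a,b]$, and similarly for other intervals; $I_A$ is the indicator function of $A$; $\mathbb{N}$ excludes $0$. *)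

(* Defs.v *)
From mathcomp Require Import all_boot all_order all_algebra.
From mathcomp Require Import all_classical all_reals all_analysis.

Set Implicit Arguments.
Unset Strict Implicit.
Unset Printing Implicit Defensive.

Import Order.TTheory GRing.Theory Num.Theory.
Import numFieldNormedType.Exports.

Local Open Scope classical_set_scope.
Local Open Scope ring_scope.

(* The library's [algebraOfSetsType] is built on pointed types, which would
   exclude the empty space; a field of sets is therefore a plain set system
   on an arbitrary type. *)
Definition is_field (X : Type) (A : set (set X)) : Prop :=
  [/\ A set0, setC_closed A & setU_closed A].

(* The values of [mu] outside of [A] are irrelevant. *)
Definition is_charge (R : realType) (X : Type) (A : set (set X))
    (mu : set X -> R) : Prop :=
  [/\ mu set0 = 0,
      forall B, A B -> 0 <= mu B &
      forall B C, A B -> A C -> B `&` C = set0 -> mu (B `|` C) = mu B + mu C].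

Section charge_spaces.
Variables (R : realType) (X : Type) (A : set (set X)) (mu : set X -> R).

(* The infimum is over a set of nonnegative reals which contains [mu setT]. *)
Definition outer_charge (S : set X) : R :=
  inf [set mu B | B in [set B | A B /\ S `<=` B]].

Definition hazily_cvg (s : nat -> X -> R) (f : X -> R) : Prop :=
  forall e : R, 0 < e ->
    outer_charge [set x | e < `|s n x - f x|] @[n --> \oo] --> (0 : R).

(* The field [F] is a parameter because simple functions are needed for [A]
   and for its Peano-Jordan completion. *)
Definition simple_rep (F : set (set X)) (f : X -> R) (K : nat)
    (c : 'I_K -> R) (B : 'I_K -> set X) : Prop :=
  [/\ partition [set: 'I_K] B [set: X],
      forall k, F (B k) &
      f = fun x => \sum_(k < K) c k * \1_(B k) x].

Definition simple_function (F : set (set X)) (f : X -> R) : Prop :=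
  exists (K : nat) (c : 'I_K -> R) (B : 'I_K -> set X), simple_rep F f c B.

(* The value does not depend on the representation; it is 0 by convention when
   [f] is not simple with respect to [A]. *)
Definition simple_integral (f : X -> R) : R :=
  xget 0 [set v | exists (K : nat) (c : 'I_K -> R) (B : 'I_K -> set X),
    simple_rep A f c B /\ v = \sum_(k < K) c k * mu (B k)].

Definition L0 : set (X -> R) :=
  [set f | exists2 s : nat -> X -> R,
    (forall n, simple_function A (s n)) & hazily_cvg s f].

Definition determining_seq (s : nat -> X -> R) (f : X -> R) : Prop :=
  [/\ forall n, simple_function A (s n),
      hazily_cvg s f &
      simple_integral (fun x => `|s p.1 x - s p.2 x|)
        @[p --> (\oo, \oo)] --> (0 : R)].

Definition L1 : set (X -> R) := [set f | exists s, determining_seq s f].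

(* The limit does not depend on the determining sequence; the value is 0 by
   convention when [f] is not in [L1]. *)
Definition charge_integral (f : X -> R) : R :=
  xget 0 [set v | exists2 s, determining_seq s f &
    simple_integral (s n) @[n --> \oo] --> v].

Definition pj_completion : set (set X) :=
  [set S | forall e : R, 0 < e ->
    exists B C, [/\ A B, A C, B `<=` S, S `<=` C & mu (C `\` B) < e]].

End charge_spaces.

Definition level_count (n : nat) : nat := (n * 2 ^ n)%N.

(* The levels are indexed from 1: [y 1, ..., y K]. *)
Definition staircase (R : realType) (X : Type) (K : nat) (y : nat -> R)
    (g : X -> R) : X -> R :=
  fun x => \sum_(1 <= j < K) y j * \1_(g @^-1` `]y j, y j.+1]) x
           + y K * \1_(g @^-1` `]y K, +oo[) x.

(* Main.v *)
(* Let N(g) be the supremum over k of the upper integrals of min(|g|, k).  It is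
   a seminorm (with values in [0, oo]), it bounds outer charges by Markov's
   inequality, and it is lower semicontinuous for hazy convergence.  Hence f is
   integrable iff it is an N-limit of simple functions, and N(f) is the integral
   of f when f is nonnegative.
   (1 => 2) Hazy limits f of simple functions have [f > y] in the completion at
   every continuity point y of the monotone function y |-> mu^*(f > y); and if s
   is simple with |s| <= M then |f| is at most 2|f - s| where |f| > 2M.
   (2 => 3) Dyadic cells contain levels avoiding the countable exceptional set,
   and the staircase differs from f^+ by at most 2^(1-n) below the top level.
   (3 => 1) The staircases are N-Cauchy and integrable, hence so are their hazy
   limits f^+ and f^-. *)
Require Import Defs.
From mathcomp Require Import all_boot all_order all_algebra.
From mathcomp Require Import all_classical all_reals all_analysis.
From mathcomp Require Import lra.
Set Implicit Arguments.
Unset Strict Implicit.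
Unset Printing Implicit Defensive.

Import Order.TTheory GRing.Theory Num.Theory.
Import numFieldNormedType.Exports.
Local Open Scope classical_set_scope.
Local Open Scope ring_scope.

(** * Countable sets, jumps of monotone functions and null sequences of reals *)

Lemma countable_setU (T : Type) (B C : set T) :
  countable B -> countable C -> countable (B `|` C).
Proof.
move=> cB cC; rewrite -bigcup2E; apply: bigcup_countable => // i _.
by case: i => [|[|i]].
Qed.

Section real_line.
Variable R : realType.
Implicit Types (h : R -> R) (C : set R).

(* A jump of [h] is labelled by a rational number lying strictly inside it;
   distinct jumps get distinct labels. *)
Lemma countable_jumps h : {homo h : x y / x <= y >-> y <= x} ->
  countable [set y | ~ forall e : R, 0 < e ->
                       exists2 d : R, 0 < d & h (y - d) - h (y + d) < e].
Proof.
move=> h_mono; set D := [set y | _].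
have label y : D y -> exists q : rat, (forall z, y < z -> h z < ratr q) /\
                                      (forall z, z < y -> ratr q < h z).
  move=> /existsNP[e /not_implyP[e_gt0 /forall2NP he]].
  (* Failure at [y] fixes one [e] bounding the drop of [h] across [y] from below, however close the
     two points are. *)
  have gap (z w : R) : z < y -> y < w -> h w + e <= h z.
    move=> zy yw; pose d := Num.min (y - z) (w - y).
    have d_gt0 : 0 < d by rewrite lt_min !subr_gt0 zy yw.
    have [//|/negP] := he d; rewrite -leNgt => hd.
    have h1 : h (y - d) <= h z.
      by apply: h_mono; rewrite lerBrDr addrC -lerBrDr ge_min lexx.
    have h2 : h w <= h (y + d).
      by apply: h_mono; rewrite addrC -lerBrDr ge_min lexx orbT.
    lra.
  (* The label is chosen in []sup E, sup E + e[]: above all values to the right of [y] and, by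
     [gap], below all values to its left. *)
  pose E := [set h z | z in [set z | y < z]].
  have E0 : E !=set0 by exists (h (y + 1)), (y + 1) => //=; rewrite ltrDl.
  have ubE z : z < y -> ubound E (h z - e).
    by move=> zy _ [w yw <-]; rewrite lerBrDr gap.
  have hasE : has_sup E.
    by split=> //; exists (h (y - 1) - e); apply: ubE; rewrite gtrBl.
  have supEe : sup E < sup E + e by rewrite ltrDl.
  have [q] := rat_in_itvoo supEe; rewrite in_itv /= => /andP[q1 q2].
  exists q; split=> z yz.
    by apply: le_lt_trans q1; apply: ub_le_sup; [case: hasE|exists z].
  by rewrite (lt_le_trans q2)// -lerBrDr; apply: ge_sup => //; exact: ubE.
have /choice[q hq] : forall y, exists q : rat, D y ->
    (forall z, y < z -> h z < ratr q) /\ (forall z, z < y -> ratr q < h z).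
  by move=> y; have [/label[q ?]|?] := pselect (D y); [exists q|exists 0].
have lt_label x y : D x -> D y -> x < y -> q x != q y.
  move=> /hq[hx _] /hq[_ hy] xy; apply/eqP => qxy.
  (* At the midpoint of [x] and [y], [h] lies above the label of [y] and below that of [x]. *)
  have := lt_trans (hy _ (midf_lt xy).2) (hx _ (midf_lt xy).1).
  by rewrite qxy ltxx.
apply/countable_injP; exists (choice.pickle \o q) => x y /[!inE] Dx Dy.
move=> /(pcan_inj choice.pickleK) qxy.
by case: (ltgtP x y) => // xy; [have := lt_label _ _ Dx Dy xy|
  have := lt_label _ _ Dy Dx xy]; rewrite qxy eqxx.
Qed.

(** A countable set is Lebesgue null, whereas []a, b[] has measure [b - a > 0]. *)
Lemma countable_avoid C (a b : R) : countable C -> a < b ->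
  exists y, [/\ a < y, y < b & ~ C y].
Proof.
move=> cC ab; apply: contrapT => noy.
have sub : `]a, b[ `<=` C.
  move=> y /=; rewrite in_itv /= => /andP[ay yb].
  by apply: contrapT => Cy; apply: noy; exists y.
have := countable_lebesgue_measure0 (sub_countable (subset_card_le sub) cC).
rewrite lebesgue_measure_itv /= lte_fin ab -EFinB => /eqP.
by rewrite eqe subr_eq0 gt_eqF.
Qed.

Lemma cvg0P (u : nat -> R) : u @ \oo --> (0 : R) <->
  forall e : R, 0 < e -> exists N, forall n, (N <= n)%N -> `|u n| < e.
Proof.
split=> [/cvgrPdist_lt u0 e /u0[N _ hN]|hu].
  by exists N => n Nn; have := hN _ Nn; rewrite /= sub0r normrN.
apply/cvgrPdist_lt => e /hu[N hN].
by exists N => // n /= Nn; rewrite sub0r normrN hN.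
Qed.

Lemma cvg_pairs0P (u : nat * nat -> R) : u @ (\oo, \oo) --> (0 : R) <->
  forall e : R, 0 < e ->
    exists N, forall m n, (N <= m)%N -> (N <= n)%N -> `|u (m, n)| < e.
Proof.
split=> [/cvgrPdist_lt u0 e /u0[[P Q] /= [[M _ hM] [N _ hN]] hPQ]|hu].
  exists (maxn M N) => m n; rewrite !geq_max => /andP[Mm _] /andP[_ Nn].
  by have := hPQ (m, n) (conj (hM _ Mm) (hN _ Nn)); rewrite /= sub0r normrN.
apply/cvgrPdist_lt => e /hu[N hN].
exists ([set n | (N <= n)%N], [set n | (N <= n)%N]) => /=.
  by split; exists N.
by move=> [m n] /= [Nm Nn]; rewrite sub0r normrN hN.
Qed.

End real_line.

(** * Fields of sets and their simple functions *)

Section fields.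
Variables (X : Type) (A : set (set X)).
Hypothesis fieldA : is_field A.

Lemma field_set0 : A set0. Proof. by case: fieldA. Qed.

Lemma field_setC B : A B -> A (~` B).
Proof. by case: fieldA => _ + _; apply. Qed.

Lemma field_setU B C : A B -> A C -> A (B `|` C).
Proof. by case: fieldA => _ _; apply. Qed.

Lemma field_setT : A setT.
Proof. by rewrite -setC0; exact/field_setC/field_set0. Qed.

Lemma field_setI B C : A B -> A C -> A (B `&` C).
Proof.
by move=> AB AC; rewrite -[_ `&` _]setCK setCI; apply/field_setC/field_setU;
  exact: field_setC.
Qed.

Lemma field_setD B C : A B -> A C -> A (B `\` C).
Proof. by move=> AB AC; rewrite setDE; apply/field_setI/field_setC. Qed.

Lemma field_bigcup (I : choiceType) (D : set I) (G : I -> set X) :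
  finite_set D -> (forall i, D i -> A (G i)) -> A (\bigcup_(i in D) G i).
Proof.
move=> /finite_seqP[s ->]; elim: s => [|i s IHs] AG.
  by rewrite classical_sets.set_nil bigcup_set0; exact: field_set0.
rewrite (_ : [set` i :: s] = i |` [set` s]); last first.
  by apply/seteqP; split=> j; rewrite /= in_cons => /predU1P.
rewrite bigcup_setU1; apply: field_setU.
  by apply: AG; rewrite /= mem_head.
by apply: IHs => j js; apply: AG; rewrite /= in_cons js orbT.
Qed.

Section simple_functions.
Variable R : realType.
Implicit Types f g : X -> R.

(** Finite range and fibres in [A] do not mention a representation, which makes closure under
    pointwise operations a matter of finite unions of fibres. *)
Lemma simple_functionP f : simple_function A f <->
  finite_set (range f) /\ forall v, A (f @^-1` [set v]).
Proof.
split=> [[K [c [B [[covB disjB _] AB ->]]]]|[/finite_seqP[s rs] Af]].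
  set f' := fun x => _.
  have fE k x : B k x -> f' x = c k.
    move=> Bkx; rewrite /f' (bigD1 k)//= indicE mem_set// mulr1.
    rewrite big1 ?addr0// => j jk; rewrite indicE memNset ?mulr0// => Bjx.
    by move/eqP: jk; apply; apply: disjB => //; exists x.
  have cov x : exists k, B k x.
    by have : [set: X] x by []; rewrite -covB => -[k _ Bkx]; exists k.
  split.
    apply: (@sub_finite_set _ _ (range c)); last exact: finite_image.
    by move=> _ [x _ <-]; have [k /fE ->] := cov x; exists k.
  move=> v; rewrite (_ : _ @^-1` _ = \bigcup_(k in [set k | c k = v]) B k).
    apply: field_bigcup => [|k _]; [exact: finite_finset|exact: AB].
  apply/seteqP; split=> x /=; last by move=> [k /= <- /fE].
  by have [k Bkx] := cov x; rewrite (fE _ _ Bkx) => ckv; exists k.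
(* [undup] lists each value once, so the fibres over its entries are pairwise disjoint; each is
   nonempty because every listed value is attained. *)
pose t := undup s.
have mem_t x : f x \in t.
  by rewrite mem_undup; have : [set` s] (f x) by rewrite -rs; exists x.
pose B (k : 'I_(size t)) := f @^-1` [set t`_k].
have idx x : (index (f x) t < size t)%N by rewrite index_mem.
exists (size t), (fun k => t`_k), B; split; first split.
- apply/seteqP; split=> // x _; exists (Ordinal (idx x)) => //.
  by rewrite /B /= nth_index.
- move=> j k _ _ [x [/= fj fk]]; apply/val_inj/eqP.
  by rewrite -(nth_uniq 0 (ltn_ord j) (ltn_ord k) (undup_uniq s)) -fj fk.
- move=> k _; have : [set` s] t`_k by rewrite /= -mem_undup mem_nth.
  by rewrite -rs => -[x _ fx]; exists x.
- by move=> k; exact: Af.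
- apply/funext => x; rewrite (bigD1 (Ordinal (idx x)))//= big1 => [|k /eqP kx].
    by rewrite indicE mem_set ?nth_index// /B /= ?nth_index// mulr1 addr0.
  rewrite indicE memNset ?mulr0// => /= fx; apply: kx; apply/val_inj => /=.
  by rewrite fx index_uniq// undup_uniq.
Qed.

(** [phi] is arbitrary: a fibre of the composite is the union of the sets where [(f, g)] takes one
    of finitely many pairs of values. *)
Lemma simple_comp2 (phi : R -> R -> R) f g :
  simple_function A f -> simple_function A g ->
  simple_function A (fun x => phi (f x) (g x)).
Proof.
move=> /simple_functionP[rf Af] /simple_functionP[rg Ag].
apply/simple_functionP; split.
  apply: (@sub_finite_set _ _ ((fun p => phi p.1 p.2) @` (range f `*` range g))).
    by move=> _ [x _ <-]; exists (f x, g x) => //; split; exists x.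
  exact/finite_image/finite_setX.
move=> v; rewrite (_ : _ @^-1` _ =
  \bigcup_(p in (range f `*` range g) `&` [set p | phi p.1 p.2 = v])
    (f @^-1` [set p.1] `&` g @^-1` [set p.2])).
  apply: field_bigcup; first exact/finite_setIl/finite_setX.
  by move=> p _; exact: field_setI.
apply/seteqP; split=> x /=.
  by move=> phiv; exists (f x, g x) => //; do !split; exists x.
by move=> [[a b] [_ /= <-] [-> ->]].
Qed.

Lemma simple_comp (phi : R -> R) f :
  simple_function A f -> simple_function A (fun x => phi (f x)).
Proof. by move=> sf; exact: (simple_comp2 (fun a _ => phi a) sf sf). Qed.

Lemma simple_preimage f (P : set R) : simple_function A f -> A (f @^-1` P).
Proof.
move=> /simple_functionP[rf Af].
rewrite (_ : _ @^-1` _ = \bigcup_(v in range f `&` P) f @^-1` [set v]).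
  by apply: field_bigcup; [exact: finite_setIl|move=> v _; exact: Af].
by apply/seteqP; split=> x /=; [exists (f x)|move=> [v [_ Pv] ->]].
Qed.

Lemma simple_indic B : A B -> simple_function A (\1_B : X -> R).
Proof.
move=> AB; apply/simple_functionP; split.
  apply: (@sub_finite_set _ _ [set 0; 1]) => //.
  by move=> _ [x _ <-]; rewrite indicE; case: (x \in B); [right|left].
move=> v; rewrite preimage_indic.
by case: ifP => _; case: ifP => _ //;
  [exact: field_setT|exact: field_setC|exact: field_set0].
Qed.

Lemma simple_cst (c : R) : simple_function A (fun=> c).
Proof.
exact: (simple_comp (fun=> c) (simple_indic field_set0)).
Qed.

Lemma simple_function_bounded f : simple_function A f ->
  exists2 M, 0 < M & forall x, `|f x| <= M.
Proof.
move=> /simple_functionP[/finite_seqP[s rs] _].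
(* The added [1] keeps the bound positive even when [f] vanishes or [X] is empty. *)
exists (1 + \sum_(v <- s) `|v|); first by rewrite ltr_pwDl// sumr_ge0.
move=> x; have fs : [set` s] (f x) by rewrite -rs; exists x.
by rewrite (big_rem _ fs) /= addrCA lerDl addr_ge0// sumr_ge0.
Qed.

Lemma simple_sum (I : eqType) (s : seq I) (g : I -> X -> R) :
  (forall i, i \in s -> simple_function A (g i)) ->
  simple_function A (fun x => \sum_(i <- s) g i x).
Proof.
elim: s => [|i s IHs] sg.
  by under eq_fun do rewrite big_nil; exact: simple_cst.
under eq_fun do rewrite big_cons.
apply: (simple_comp2 +%R); first by apply: sg; rewrite mem_head.
by apply: IHs => j js; apply: sg; rewrite in_cons js orbT.
Qed.

End simple_functions.
End fields.

(** * Charges, outer charges and the integral of simple functions *)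

Section charges.
Variables (R : realType) (X : Type) (A : set (set X)) (mu : set X -> R).
Hypotheses (fieldA : is_field A) (chargemu : is_charge A mu).
Local Notation I := (simple_integral A mu).
Implicit Types (B C : set X) (f g h s : X -> R).

Lemma charge_ge0 B : A B -> 0 <= mu B.
Proof. by case: chargemu => _ + _; apply. Qed.

Lemma charge_setU B C : A B -> A C -> B `&` C = set0 ->
  mu (B `|` C) = mu B + mu C.
Proof. by case: chargemu => _ _; apply. Qed.

Lemma charge_setID B C : A B -> A C -> mu B = mu (C `&` B) + mu (B `\` C).
Proof.
move=> AB CA; rewrite -charge_setU; first 1 last.
- exact: field_setI.
- exact: field_setD.
- by rewrite -setIA setIDA setIC setDE; apply/seteqP; split=> x /=; tauto.
by congr mu; apply/seteqP; split=> x /=; have := pselect (C x); tauto.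
Qed.

Lemma charge_le B C : A B -> A C -> B `<=` C -> mu B <= mu C.
Proof.
move=> AB CA BC; rewrite (charge_setID CA AB) setIidl//.
by rewrite lerDl charge_ge0//; exact: field_setD.
Qed.

Lemma charge_setD B C : A B -> A C -> B `<=` C -> mu (C `\` B) = mu C - mu B.
Proof. by move=> AB CA BC; rewrite (charge_setID CA AB) setIidl// addrC addKr. Qed.

Lemma charge_leU B C : A B -> A C -> mu (B `|` C) <= mu B + mu C.
Proof.
move=> AB CA; have AU := field_setU fieldA AB CA.
rewrite (charge_setID AU AB) lerD//.
  by apply: charge_le (@subIsetl _ _ _) => //; exact: field_setI.
by apply: charge_le => [||x [[]]]//; exact: field_setD.
Qed.

Section outer_charge.
Implicit Types S T : set X.

(** Guarantees that the [inf] in [outer_charge] is a genuine infimum and not a default value. *)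
Let outer_has_inf S : has_inf [set mu B | B in [set B | A B /\ S `<=` B]].
Proof.
split; last by exists 0 => _ [B [AB _] <-]; exact: charge_ge0.
by exists (mu setT), setT => //; split=> //; exact: field_setT.
Qed.

Lemma outer_charge_le S B : A B -> S `<=` B -> outer_charge A mu S <= mu B.
Proof. by move=> AB SB; apply: ge_inf; [case: (outer_has_inf S)|exists B]. Qed.

Lemma outer_charge_ge S (c : R) :
  (forall B, A B -> S `<=` B -> c <= mu B) -> c <= outer_charge A mu S.
Proof.
move=> cle; apply: lb_le_inf; first by case: (outer_has_inf S).
by move=> _ [B [AB SB] <-]; exact: cle.
Qed.

Lemma outer_charge_ge0 S : 0 <= outer_charge A mu S.
Proof. by apply: outer_charge_ge => B AB _; exact: charge_ge0. Qed.

Lemma outer_charge_adherent S (e : R) : 0 < e ->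
  exists B, [/\ A B, S `<=` B & mu B < outer_charge A mu S + e].
Proof.
by move=> /inf_adherent /(_ (outer_has_inf S)) [_ [B [AB SB] <-] ?]; exists B.
Qed.

Lemma outer_charge_mono S T : S `<=` T ->
  outer_charge A mu S <= outer_charge A mu T.
Proof.
move=> ST; apply: outer_charge_ge => B AB TB; apply: outer_charge_le => //.
exact: subset_trans TB.
Qed.

(** Replaces outer charges by covering sets from [A], so that later estimates involve [mu] only. *)
Lemma hazily_cvgP (u : nat -> X -> R) f : hazily_cvg A mu u f <->
  forall d e : R, 0 < d -> 0 < e -> exists N, forall n, (N <= n)%N ->
    exists B, [/\ A B, [set x | d < `|u n x - f x|] `<=` B & mu B < e].
Proof.
split=> [hu d e d0 e0|hu d d0].
  have e20 : 0 < e / 2 by rewrite divr_gt0.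
  have /cvg0P/(_ _ e20)[N hN] := hu d d0; exists N => n /hN.
  rewrite ger0_norm ?outer_charge_ge0// => hn.
  have [B [AB SB muB]] := outer_charge_adherent [set x | d < `|u n x - f x|] e20.
  by exists B; split=> //; lra.
apply/cvg0P => e e0; have [N hN] := hu d e d0 e0; exists N => n /hN[B [AB SB muB]].
by rewrite ger0_norm ?outer_charge_ge0// (le_lt_trans _ muB)// outer_charge_le.
Qed.

End outer_charge.

(* Splitting the domain [D] along the first set of the list reduces a sum over
   arbitrary, possibly overlapping, sets to a shorter one. *)
Lemma charge_sum_ge0 (l : seq (R * {B | A B})) (c : R) (D : set X) : A D ->
  (forall x, D x -> 0 <= c + \sum_(p <- l) p.1 * \1_(sval p.2) x) ->
  0 <= c * mu D + \sum_(p <- l) p.1 * mu (sval p.2 `&` D).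
Proof.
elim: l c D => [|[a [B AB]] l IHl] c D AD hge.
  (* On an empty [D] the sign of [c] is unknown, but [mu D] is zero. *)
  rewrite big_nil addr0; have [D0|/set0P[x Dx]] := eqVneq D set0.
    by rewrite D0; case: chargemu => -> _ _; rewrite mulr0.
  by have := hge x Dx; rewrite big_nil addr0 => c0; rewrite mulr_ge0 ?charge_ge0.
have ABD := field_setI fieldA AB AD; have ADB := field_setD fieldA AD AB.
have split_sum : \sum_(p <- l) p.1 * mu (sval p.2 `&` D) =
    \sum_(p <- l) p.1 * mu (sval p.2 `&` (B `&` D)) +
    \sum_(p <- l) p.1 * mu (sval p.2 `&` (D `\` B)).
  rewrite -big_split; apply: eq_bigr => -[b [C CA]] _ /=; rewrite -mulrDr.
  rewrite (charge_setID (field_setI fieldA CA AD) AB); congr (_ * (mu _ + mu _)).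
    by rewrite setICA.
  by rewrite setIDA.
(* On the part of [D] inside [B] the head coefficient [a] joins the constant [c]; outside [B] its
   term vanishes. *)
have h1 := IHl (c + a) _ ABD _; have h2 := IHl c _ ADB _.
rewrite big_cons /= split_sum (charge_setID AD AB) mulrDr.
have {}h1 : 0 <= (c + a) * mu (B `&` D) +
    \sum_(p <- l) p.1 * mu (sval p.2 `&` (B `&` D)).
  apply: h1 => x [Bx Dx]; have := hge x Dx.
  by rewrite big_cons /= indicE mem_set// mulr1 addrA.
have {}h2 : 0 <= c * mu (D `\` B) +
    \sum_(p <- l) p.1 * mu (sval p.2 `&` (D `\` B)).
  apply: h2 => x [Dx Bx]; have := hge x Dx.
  by rewrite big_cons /= indicE memNset// mulr0 add0r.
by move: h1; rewrite mulrDl; lra.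
Qed.

(** The difference of the two sums is again such a sum, over [n], so nonnegativity on the whole
    space applies. This yields both monotonicity of the integral and independence of the
    representation. *)
Lemma charge_sum_le (l m : seq (R * {B | A B})) :
  (forall x, \sum_(p <- l) p.1 * \1_(sval p.2) x <=
             \sum_(p <- m) p.1 * \1_(sval p.2) x) ->
  \sum_(p <- l) p.1 * mu (sval p.2) <= \sum_(p <- m) p.1 * mu (sval p.2).
Proof.
move=> lm; pose n := m ++ [seq (- p.1, p.2) | p <- l].
have sumB (F : {B | A B} -> R) : \sum_(p <- n) p.1 * F p.2 =
    \sum_(p <- m) p.1 * F p.2 - \sum_(p <- l) p.1 * F p.2.
  rewrite big_cat big_map -sumrN /=; congr (_ + _).
  by apply: eq_bigr => p _; rewrite mulNr.
have := @charge_sum_ge0 n 0 setT (field_setT fieldA) _.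
rewrite (sumB (fun B : {B | A B} => mu (sval B `&` setT))) mul0r add0r.
under eq_bigr do rewrite setIT; under [X in _ - X]eq_bigr do rewrite setIT.
rewrite subr_ge0; apply => x _.
by rewrite (sumB (fun B : {B | A B} => \1_(sval B) x)) add0r subr_ge0.
Qed.

(** Lists of possibly overlapping sets, unlike partitions, can be scaled and concatenated freely, so
    linearity reduces to operations on lists. *)
Lemma simple_list f : simple_function A f ->
  exists l : seq (R * {B | A B}),
    f = (fun x => \sum_(p <- l) p.1 * \1_(sval p.2) x) /\
    I f = \sum_(p <- l) p.1 * mu (sval p.2).
Proof.
move=> sf; have [K [c [B [[_ AB fE] IE]]]] :
    exists K (c : 'I_K -> R) (B : 'I_K -> set X),
      simple_rep A f c B /\ I f = \sum_(k < K) c k * mu (B k).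
  (* [f] has a representation, so the default value of [xget] is excluded. *)
  rewrite /simple_integral; case: xgetP => [v _ //|noval].
  have [K [c [B hB]]] := sf.
  by case: (noval (\sum_(k < K) c k * mu (B k))); exists K, c, B.
exists [seq (c k, exist A (B k) (AB k)) | k <- enum 'I_K].
by split; [rewrite fE; apply/funext => x|]; rewrite ?IE big_map big_enum.
Qed.

(** Two lists representing [f] bound each other's sums by [charge_sum_le]. *)
Lemma simple_integralE f (l : seq (R * {B | A B})) : simple_function A f ->
  f = (fun x => \sum_(p <- l) p.1 * \1_(sval p.2) x) ->
  I f = \sum_(p <- l) p.1 * mu (sval p.2).
Proof.
move=> /simple_list[m [fm ->]] fl; apply/eqP; rewrite eq_le.
by apply/andP; split; apply: charge_sum_le => x; have := congr1 (@^~ x) fm;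
  rewrite fl /= => ->.
Qed.

Lemma simple_integral_le f g : simple_function A f -> simple_function A g ->
  (forall x, f x <= g x) -> I f <= I g.
Proof.
by move=> /simple_list[l [-> ->]] /simple_list[m [-> ->]]; exact: charge_sum_le.
Qed.

Lemma simple_integral_indic B : A B -> I (\1_B) = mu B.
Proof.
move=> AB; rewrite (@simple_integralE _ [:: (1, exist A B AB)]).
- by rewrite big_seq1 mul1r.
- exact: simple_indic.
- by apply/funext => x; rewrite big_seq1 mul1r.
Qed.

Lemma simple_integral_linear (a : R) f g :
  simple_function A f -> simple_function A g ->
  I (fun x => a * f x + g x) = a * I f + I g.
Proof.
move=> sf sg; have sfg := simple_comp2 fieldA (fun u v => a * u + v) sf sg.
have [l [fE ->]] := simple_list sf; have [m [gE ->]] := simple_list sg.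
rewrite (@simple_integralE _ ([seq (a * p.1, p.2) | p <- l] ++ m))//.
  rewrite big_cat big_map mulr_sumr /=; congr (_ + _).
  by apply: eq_bigr => p _; rewrite mulrA.
apply/funext => x; rewrite big_cat big_map fE gE mulr_sumr /=; congr (_ + _).
by apply: eq_bigr => p _; rewrite mulrA.
Qed.

Lemma simple_integralZ (a : R) f : simple_function A f ->
  I (fun x => a * f x) = a * I f.
Proof.
move=> sf; have s0 := simple_cst fieldA (0 : R).
have I0 : I (fun=> 0) = 0.
  rewrite (@simple_integralE _ [::])// ?big_nil//.
  by apply/funext => x; rewrite big_nil.
rewrite -[RHS]addr0 -I0 -simple_integral_linear//.
by congr I; apply/funext => x; rewrite addr0.
Qed.

End charges.

(** * The upper-integral seminorm and its relation to hazy convergence *)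

Section upper_integral.
Variables (R : realType) (X : Type) (A : set (set X)) (mu : set X -> R).
Hypotheses (fieldA : is_field A) (chargemu : is_charge A mu).
Local Notation I := (simple_integral A mu).
Local Notation simple := (simple_function A).
Implicit Types (B C : set X) (f g h s : X -> R) (c e : R).

Let simpleD f g : simple f -> simple g -> simple (fun x => f x + g x).
Proof. by move=> sf sg; exact: (simple_comp2 fieldA +%R). Qed.

Let simpleB f g : simple f -> simple g -> simple (fun x => f x - g x).
Proof. by move=> sf sg; exact: (simple_comp2 fieldA (fun a b => a - b)). Qed.

Let simpleZ (a : R) f : simple f -> simple (fun x => a * f x).
Proof. by move=> sf; exact: (simple_comp fieldA ( *%R a)). Qed.

Let simple_norm f : simple f -> simple (fun x => `|f x|).
Proof. by move=> sf; exact: (simple_comp fieldA Num.norm). Qed.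

Let simpleI B : A B -> simple (\1_B : X -> R). Proof. exact: simple_indic. Qed.

Let simple_c c : simple (fun=> c). Proof. exact: simple_cst. Qed.

Lemma simple_integralD f g : simple f -> simple g ->
  I (fun x => f x + g x) = I f + I g.
Proof.
move=> sf sg; rewrite -[I f in RHS]mul1r -simple_integral_linear//.
by congr I; apply/funext => x; rewrite mul1r.
Qed.

Lemma simple_integralB f g : simple f -> simple g ->
  I (fun x => f x - g x) = I f - I g.
Proof.
move=> sf sg; rewrite addrC -mulN1r -simple_integral_linear//.
by congr I; apply/funext => x; rewrite mulN1r addrC.
Qed.

Lemma simple_integral_cst c : I (fun=> c) = c * mu setT.
Proof.
rewrite -(simple_integral_indic fieldA chargemu (field_setT fieldA)).
rewrite -simple_integralZ//; last by apply: simpleI; exact: field_setT.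
by congr I; apply/funext => x; rewrite indicT mulr1.
Qed.

Lemma simple_integral_norm f : simple f -> `|I f| <= I (fun x => `|f x|).
Proof.
move=> sf; rewrite ler_norml; apply/andP; split; last first.
  by apply: simple_integral_le => // [|x]; [exact: simple_norm|exact: ler_norm].
rewrite -mulN1r -simple_integralZ//; last exact: simple_norm.
apply: simple_integral_le => // [|x]; first exact/simpleZ/simple_norm.
by rewrite mulN1r lerNl -normrN ler_norm.
Qed.

Lemma simple_integral_ge0 f : simple f -> (forall x, 0 <= f x) -> 0 <= I f.
Proof.
move=> sf f0; rewrite -(mul0r (mu setT)) -simple_integral_cst.
exact: simple_integral_le.
Qed.

(* [upper_le g c] says that the upper integral of [|g|], the supremum over [k]
   of the upper integrals of the truncations of [|g|] at [k], is at most [c]. *)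
Definition upper_le g c : Prop := forall k e : R, 0 < k -> 0 < e ->
  exists s, [/\ simple s, forall x, Num.min `|g x| k <= s x & I s <= c + e].

Lemma upper_le_mono g h c d : (forall x, `|g x| <= `|h x|) -> c <= d ->
  upper_le h c -> upper_le g d.
Proof.
move=> gh cd hc k e k0 e0; have [s [ss hs Is]] := hc k e k0 e0.
exists s; split=> [//|x|]; last by rewrite (le_trans Is)// lerD2r.
by rewrite (le_trans _ (hs x))// le_min !ge_min gh lexx orbT.
Qed.

(** Truncation is subadditive: [min(|g + h|, k) <= min(|g|, k) + min(|h|, k)]. *)
Lemma upper_leD g h c d : upper_le g c -> upper_le h d ->
  upper_le (fun x => g x + h x) (c + d).
Proof.
move=> gc hd k e k0 e0; have e20 : 0 < e / 2 by rewrite divr_gt0.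
have [s [ss gs Is]] := gc k _ k0 e20; have [t [st ht It]] := hd k _ k0 e20.
exists (fun x => s x + t x); split=> [|x|]; first exact: simpleD.
  apply: le_trans (lerD (gs x) (ht x)); have := ler_normD (g x) (h x).
  have := normr_ge0 (g x); have := normr_ge0 (h x).
  by rewrite ge_min /Num.min; case: ifP => _; case: ifP => _ *; apply/orP; lra.
by rewrite simple_integralD//; lra.
Qed.

(** Truncating [a * g] at [k] amounts to truncating [g] at [k / a]. *)
Lemma upper_leZ (a : R) g c : 0 < a -> upper_le g c ->
  upper_le (fun x => a * g x) (a * c).
Proof.
move=> a0 gc k e k0 e0.
have [s [ss gs Is]] := gc _ _ (divr_gt0 k0 a0) (divr_gt0 e0 a0).
exists (fun x => a * s x); split=> [|x|]; first exact: simpleZ.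
  by rewrite normrM gtr0_norm// ge_min ler_pM2l// [a * _]mulrC -ler_pdivrMr// -ge_min.
rewrite simple_integralZ//; move: Is; rewrite -(ler_pM2l a0) mulrDr.
by rewrite mulrCA divff ?gt_eqF// mulr1.
Qed.

Lemma upper_le_closed g c : (forall e, 0 < e -> upper_le g (c + e)) ->
  upper_le g c.
Proof.
move=> gc k e k0 e0; have e20 : 0 < e / 2 by rewrite divr_gt0.
have [s [ss gs Is]] := gc _ e20 k _ k0 e20.
by exists s; split=> //; rewrite (le_trans Is)// -addrA -splitr.
Qed.

Lemma upper_le_ge0 g c : upper_le g c -> 0 <= c.
Proof.
move=> gc; apply/ler_addgt0Pr => e e0; have [s [ss gs Is]] := gc _ e ltr01 e0.
apply: le_trans Is; apply: simple_integral_ge0 => // x.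
by rewrite (le_trans _ (gs x))// le_min normr_ge0 ler01.
Qed.

Lemma upper_le_bound g s : simple s -> (forall x, `|g x| <= s x) ->
  upper_le g (I s).
Proof.
move=> ss gs k e k0 e0; exists s; split=> // [x|]; last by rewrite lerDl ltW.
by rewrite ge_min gs.
Qed.

Lemma upper_le_cst c : 0 <= c -> upper_le (fun=> c) (c * mu setT).
Proof.
move=> c0; rewrite -simple_integral_cst; apply: upper_le_bound => // _.
by rewrite ger0_norm.
Qed.

Lemma upper_le_indic B (a : R) : A B -> 0 <= a ->
  upper_le (fun x => a * \1_B x) (a * mu B).
Proof.
move=> AB a0; rewrite -(simple_integral_indic fieldA chargemu AB).
rewrite -simple_integralZ//; last exact: simpleI.
apply: upper_le_bound => [|x]; first exact/simpleZ/simpleI.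
by rewrite ger0_norm// mulr_ge0.
Qed.

(** A simple function is bounded by some [M], and truncating [|s|] at [M] leaves it unchanged. *)
Lemma upper_le_simple s c : simple s -> upper_le s c -> I (fun x => `|s x|) <= c.
Proof.
move=> ss sc; have [M M0 sM] := simple_function_bounded fieldA ss.
apply/ler_addgt0Pr => e e0; have [t [st ht It]] := sc M e M0 e0.
apply: le_trans It; apply: simple_integral_le => // [|x]; first exact: simple_norm.
by have := ht x; rewrite min_l.
Qed.

(** Markov's inequality, applied to a simple majorant [s] of the truncation at [d]. The covering set
    is a level set of [s], hence in [A] even if that of [g] is not. *)
Lemma upper_le_markov g c d e : upper_le g c -> 0 < d -> 0 < e ->
  exists B, [/\ A B, [set x | d < `|g x|] `<=` B & d * mu B <= c + e].
Proof.
move=> gc d0 e0; have [s [ss gs Is]] := gc d e d0 e0.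
have AB : A (s @^-1` [set v | d <= v]) by exact: simple_preimage.
exists (s @^-1` [set v | d <= v]); split=> //.
  by move=> x /= dg; have := gs x; rewrite min_r// ltW.
apply: le_trans Is; rewrite -(simple_integral_indic fieldA chargemu AB).
rewrite -simple_integralZ//; last exact: simpleI.
apply: simple_integral_le => // [|x]; first exact/simpleZ/simpleI.
rewrite indicE; have s0 : 0 <= s x.
  by rewrite (le_trans _ (gs x))// le_min normr_ge0 ltW.
by have [/set_mem/=|_] := boolP (x \in _); rewrite ?mulr1 ?mulr0.
Qed.

(** Lower semicontinuity under hazy convergence. Off a small set [B] the functions [u n] and [g]
    differ by at most [d]; on [B] the truncation at [k] costs at most [k * mu B]. *)
Lemma hazily_upper_le (u : nat -> X -> R) g h N c : hazily_cvg A mu u g ->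
  (forall n, (N <= n)%N -> upper_le (fun x => u n x - h x) c) ->
  upper_le (fun x => g x - h x) c.
Proof.
move=> /(hazily_cvgP fieldA chargemu) ug uc; apply: upper_le_closed => e e0.
move=> k e' k0 e'0; have muT := charge_ge0 chargemu (field_setT fieldA).
(* The choices give [d * mu setT <= e / 2] and [k * mu B < e / 2]; the [1] keeps the denominator
   positive if [mu setT = 0]. *)
pose d := e / 2 / (mu setT + 1).
have d0 : 0 < d by rewrite !divr_gt0// ltr_wpDl.
have ek0 : 0 < e / 2 / k by rewrite !divr_gt0.
have [M hM] := ug _ _ d0 ek0.
have [B [AB dB muB]] := hM _ (leq_maxr N M).
have {}uc := uc _ (leq_maxl N M); set n := maxn N M in dB uc.
have [s [ss us Is]] := uc k e' k0 e'0.
exists (fun x => s x + (d + k * \1_B x)); split=> [|x|].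
- by apply/simpleD/simpleD => //; exact/simpleZ/simpleI.
- have := us x; have := ler_normD (u n x - h x) (g x - u n x).
  rewrite addrC subrKA => tri.
  have [xB|xB] := boolP (x \in B).
    rewrite indicE xB mulr1 => sx; have : 0 <= s x.
      by rewrite (le_trans _ sx)// le_min normr_ge0 ltW.
    by rewrite ge_min => s0; apply/orP; right; lra.
  have : `|u n x - g x| <= d.
    by rewrite leNgt; apply/negP => /dB /mem_set; exact/negP.
  rewrite indicE (negbTE xB) mulr0 addr0 distrC => dx.
  by rewrite !ge_min => /orP[] ?; apply/orP; [left|right]; lra.
- rewrite !simple_integralD//;
    do ?by [exact/simpleD/simpleZ/simpleI|exact/simpleZ/simpleI].
  rewrite simple_integral_cst simple_integralZ ?simple_integral_indic//;
    last exact: simpleI.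
  have : d * mu setT <= e / 2.
    rewrite /d -mulrA ler_piMr ?divr_ge0 ?ltW// mulrC ltr_pdivrMr ?ltr_wpDl//.
    by rewrite mul1r ltrDl.
  by move: muB; rewrite ltr_pdivlMr// => muB; lra.
Qed.

Lemma upper_le_hazily (u : nat -> X -> R) g :
  (forall e, 0 < e -> exists N, forall n, (N <= n)%N ->
     upper_le (fun x => u n x - g x) e) ->
  hazily_cvg A mu u g.
Proof.
move=> hu; apply/hazily_cvgP => // d e d0 e0.
(* Bound and slack in Markov's inequality are both [d * e / 3], so
   [d * mu B <= 2 * d * e / 3 < d * e]. *)
have de0 : 0 < d * e / 3 by rewrite divr_gt0// mulr_gt0.
have [N hN] := hu _ de0; exists N => n /hN /upper_le_markov /(_ d0 de0).
move=> [B [AB dB muB]]; exists B; split=> //.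
by rewrite -(ltr_pM2l d0) (le_lt_trans muB)//; have := mulr_gt0 d0 e0; lra.
Qed.

(** For fixed large [n], the Cauchy condition bounds [u m - u n] uniformly in large [m];
    semicontinuity carries the bound to the limit in [m]. *)
Lemma determining_upper_le (u : nat -> X -> R) f : determining_seq A mu u f ->
  forall e, 0 < e -> exists N, forall n, (N <= n)%N ->
    upper_le (fun x => f x - u n x) e.
Proof.
move=> [su uf /cvg_pairs0P cauchy] e e0; have [N hN] := cauchy e e0.
exists N => n Nn; apply: (@hazily_upper_le u f (u n) N e uf) => m Nm.
have /ltW lte := le_lt_trans (ler_norm _) (hN m n Nm Nn).
apply: upper_le_mono (fun=> lexx _) lte _; apply: upper_le_bound => //.
exact/simple_norm/simpleB.
Qed.

(** Conversely to [determining_upper_le], approximants with error [1 / (n + 1)] converge hazily by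
    Markov and are Cauchy by the triangle inequality. Closure properties of [L1] thus become
    seminorm estimates. *)
Lemma L1P f : L1 A mu f <->
  forall e, 0 < e -> exists2 s, simple s & upper_le (fun x => f x - s x) e.
Proof.
split=> [[u du] e e0|hf].
  have [N hN] := determining_upper_le du e0; exists (u N); last exact: hN.
  by case: du.
have /choice[u hu] : forall n : nat, exists s,
    simple s /\ upper_le (fun x => f x - s x) n.+1%:R^-1.
  by move=> n; have [s] := hf n.+1%:R^-1 ltac:(by []); exists s.
have small e : 0 < e -> exists N, forall n, (N <= n)%N ->
    upper_le (fun x => u n x - f x) e.
  move=> e0; have [N _ hN] := near_infty_natSinv_lt (PosNum e0).
  exists N => n /hN /= ne; apply: upper_le_mono _ (ltW ne) (hu n).2 => x.
  by rewrite distrC.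
exists u; split; first by move=> n; case: (hu n).
  exact: upper_le_hazily.
apply/cvg_pairs0P => e e0; have e30 : 0 < e / 3 by rewrite divr_gt0.
have [N hN] := small _ e30; exists N => m n Nm Nn /=.
have sB := simpleB (hu m).1 (hu n).1.
rewrite ger0_norm ?simple_integral_ge0//; last exact: simple_norm.
apply: (@le_lt_trans _ _ (e / 3 + e / 3)); last by lra.
apply: upper_le_simple => //.
have hn : upper_le (fun x => f x - u n x) (e / 3).
  by apply: upper_le_mono _ (lexx _) (hN n Nn) => x; rewrite distrC.
apply: upper_le_mono _ (lexx _) (upper_leD (hN m Nm) hn) => x.
by rewrite subrKA.
Qed.

End upper_integral.

(** * Integrable functions, the Peano-Jordan completion and level sets *)

Section integrable.
Variables (R : realType) (X : Type) (A : set (set X)) (mu : set X -> R).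
Hypotheses (fieldA : is_field A) (chargemu : is_charge A mu).
Local Notation I := (simple_integral A mu).
Local Notation simple := (simple_function A).
Local Notation upper_le := (upper_le A mu).
Local Notation L1 := (L1 A mu).
Local Notation pj := (pj_completion A mu).
Implicit Types (B C E S : set X) (f g h s : X -> R) (c e : R).

Let L1_P f := L1P fieldA chargemu f.

(** Nonnegative simple functions close to [g] in the seminorm can be chosen with integrals close to
    that of [g], and for them integral and seminorm coincide. The integral is thus accessible
    through [upper_le] alone. *)
Lemma charge_integral_upper_le g : L1 g -> (forall x, 0 <= g x) ->
  upper_le g (charge_integral A mu g) /\
  forall c, upper_le g c -> charge_integral A mu g <= c.
Proof.
move=> L1g g0.
(* The [u n] may take negative values; since [g >= 0], replacing them by [|u n|] changes little, as
   [||u n| - u n| <= ||u n| - g| + |g - u n|]. *)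
have near_u u : determining_seq A mu u g -> forall e, 0 < e -> exists N,
    forall n, (N <= n)%N -> `|I (fun x => `|u n x|) - I (u n)| <= e /\
      upper_le (fun x => g x - `|u n x|) e.
  move=> du e e0; have su n : simple (u n) by case: du.
  have e20 : 0 < e / 2 by rewrite divr_gt0.
  have [N hN] := determining_upper_le fieldA chargemu du e20.
  exists N => n /hN gu; have sn := simple_comp fieldA Num.norm (su n).
  have gun : upper_le (fun x => g x - `|u n x|) (e / 2).
    apply: upper_le_mono _ (lexx _) gu => x.
    by have := ler_dist_dist (g x) (u n x); rewrite (ger0_norm (g0 x)).
  split; last by apply: upper_le_mono gun; rewrite // ler_pdivrMr// ler_pMr// ler1n.
  rewrite -simple_integralB//.
  have sB := simple_comp2 fieldA (fun a b => a - b) sn (su n).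
  apply: (le_trans (simple_integral_norm fieldA chargemu sB)).
  apply: upper_le_simple => //; rewrite [e]splitr.
  have gun' : upper_le (fun x => `|u n x| - g x) (e / 2).
    by apply: upper_le_mono _ (lexx _) gun => x; rewrite distrC.
  apply: upper_le_mono _ (lexx _) (upper_leD fieldA chargemu gun' gu) => x.
  by rewrite subrKA.
have [u [du uv]] : exists u, determining_seq A mu u g /\
    I (u n) @[n --> \oo] --> charge_integral A mu g.
  rewrite /charge_integral; case: xgetP => [v _ [u du uv]|noval]; first by exists u.
  (* The default of [xget] is excluded: the integrals [I (u n)] form a Cauchy sequence and converge
     by completeness of the reals. *)
  have [u du] := L1g; exfalso.
  have : cvg (I (u n) @[n --> \oo]).
    apply/cauchy_cvgP/cauchy_exP => e e0.
    have [su _ /cvg_pairs0P/(_ _ e0) [N hN]] := du.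
    exists (I (u N)); exists N => // n /= Nn; rewrite /ball /= -simple_integralB//.
    have sB := simple_comp2 fieldA (fun a b => a - b) (su N) (su n).
    apply: (le_lt_trans (simple_integral_norm fieldA chargemu sB)).
    exact: le_lt_trans (ler_norm _) (hN _ _ (leqnn _) Nn).
  by move=> /cvg_ex[v uv]; apply: (noval v); exists u.
set v := charge_integral A mu g in uv *.
(* One [e] in the last bound comes from passing to [|u n|], the other from the convergence of
   [I (u n)] to [v]. *)
have approx e : 0 < e -> exists s, [/\ simple s, forall x, 0 <= s x,
    upper_le (fun x => g x - s x) e & `|v - I s| <= 2 * e].
  move=> e0; have [N hN] := near_u u du e e0.
  have /cvgrPdist_lt/(_ _ e0)[M _ hM] := uv.
  have := hM _ (leq_maxr N M); have [] := hN _ (leq_maxl N M).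
  set n := maxn N M => Inn gu /= vI; exists (fun x => `|u n x|); split=> //.
    by apply: (simple_comp fieldA Num.norm); case: du.
  apply: (le_trans (ler_distD (I (u n)) _ _)); rewrite [X in _ + X]distrC.
  lra.
have uI s : simple s -> (forall x, 0 <= s x) -> upper_le s (I s).
  by move=> ss s0; apply: upper_le_bound => // x; rewrite ger0_norm.
split=> [|c gc].
  apply: upper_le_closed => e e0; have e30 : 0 < e / 3 by rewrite divr_gt0.
  have [s [ss s0 gs]] := approx _ e30; rewrite ler_norml => /andP[vI _].
  have gsI := upper_leD fieldA chargemu gs (uI s ss s0).
  by apply: upper_le_mono gsI => [x|]; rewrite ?subrK//; lra.
apply/ler_addgt0Pr => e e0; have e30 : 0 < e / 3 by rewrite divr_gt0.
have [s [ss s0 gs]] := approx _ e30; rewrite ler_norml => /andP[_ vI].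
have sg : upper_le (fun x => s x - g x) (e / 3).
  by apply: upper_le_mono _ (lexx _) gs => x; rewrite distrC.
have scg : upper_le s (e / 3 + c).
  apply: upper_le_mono _ (lexx _) (upper_leD fieldA chargemu sg gc) => x.
  by rewrite subrK.
have := upper_le_simple fieldA chargemu ss scg.
have -> : (fun x => `|s x|) = s by apply/funext => x; rewrite ger0_norm.
by lra.
Qed.

Lemma L1_simple f : simple f -> L1 f.
Proof.
move=> sf; apply/L1_P => e e0; exists f => //.
have := upper_le_cst fieldA chargemu (lexx (0 : R)); rewrite mul0r.
by apply: upper_le_mono (ltW e0) => x; rewrite subrr.
Qed.

Lemma L1D f g : L1 f -> L1 g -> L1 (fun x => f x + g x).
Proof.
move=> /L1_P L1f /L1_P L1g; apply/L1_P => e e0.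
have e20 : 0 < e / 2 by rewrite divr_gt0.
have [s ss fs] := L1f _ e20; have [t st gt] := L1g _ e20.
exists (fun x => s x + t x); first exact: (simple_comp2 fieldA +%R).
apply: upper_le_mono (upper_leD fieldA chargemu fs gt); last by rewrite -splitr.
by move=> x; rewrite addrACA opprD.
Qed.

Lemma L1N f : L1 f -> L1 (fun x => - f x).
Proof.
move=> /L1_P L1f; apply/L1_P => e e0; have [s ss fs] := L1f _ e0.
exists (fun x => - s x); first exact: (simple_comp fieldA -%R).
by apply: upper_le_mono _ (lexx _) fs => x; rewrite -opprD normrN.
Qed.

Lemma L1_norm f : L1 f -> L1 (fun x => `|f x|).
Proof.
move=> /L1_P L1f; apply/L1_P => e e0; have [s ss fs] := L1f _ e0.
exists (fun x => `|s x|); first exact: (simple_comp fieldA Num.norm).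
by apply: upper_le_mono _ (lexx _) fs => x; exact: ler_dist_dist.
Qed.

Lemma L1_sum (J : Type) (r : seq J) (F : J -> X -> R) :
  (forall j, L1 (F j)) -> L1 (fun x => \sum_(j <- r) F j x).
Proof.
move=> L1F; elim: r => [|j r IHr].
  by under eq_fun do rewrite big_nil; exact/L1_simple/simple_cst.
by under eq_fun do rewrite big_cons; exact: L1D.
Qed.

(** Completeness: [g] inherits by semicontinuity the distance from the tail to [u N], and [u N] is
    in turn close to a simple function. *)
Lemma L1_hazily_cvg (u : nat -> X -> R) g : hazily_cvg A mu u g ->
  (forall e, 0 < e -> exists N, L1 (u N) /\
     forall n, (N <= n)%N -> upper_le (fun x => u n x - u N x) e) ->
  L1 g.
Proof.
move=> ug hu; apply/L1_P => e e0; have e20 : 0 < e / 2 by rewrite divr_gt0.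
have [N [/L1_P/(_ _ e20)[s ss us] hN]] := hu _ e20; exists s => //.
have gu := hazily_upper_le fieldA chargemu ug hN.
apply: upper_le_mono (upper_leD fieldA chargemu gu us); last by rewrite -splitr.
by move=> x; rewrite subrKA.
Qed.

Lemma pjP S : pj S <-> forall e, 0 < e -> exists B C,
  [/\ A B, A C, B `<=` S, S `<=` C & mu C - mu B < e].
Proof.
split=> hS e /hS[B [C [AB CA BS SC muCB]]]; exists B, C; split=> //.
  by rewrite -(charge_setD fieldA chargemu)//; exact: subset_trans SC.
by rewrite (charge_setD fieldA chargemu)//; exact: subset_trans SC.
Qed.

Lemma sub_pj B : A B -> pj B.
Proof. by move=> AB; apply/pjP => e e0; exists B, B; rewrite subrr; split. Qed.

Lemma pj_field : is_field pj.
Proof.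
split=> [|S pS|S T pS pT].
- exact: sub_pj (field_set0 fieldA).
- move=> e /pS[B [C [AB CA BS SC muCB]]]; exists (~` C), (~` B).
  split; [exact: field_setC|exact: field_setC|exact: subsetC|exact: subsetC|].
  by rewrite setDE setCK setIC -setDE.
- move=> e e0; have e20 : 0 < e / 2 by rewrite divr_gt0.
  have [B [C [AB CA BS SC muCB]]] := pS _ e20.
  have [B' [C' [AB' CA' BS' SC' muCB']]] := pT _ e20.
  have AU : A (B `|` B') by exact: field_setU.
  have CU : A (C `|` C') by exact: field_setU.
  exists (B `|` B'), (C `|` C'); split=> //; [exact: setUSS|exact: setUSS|].
  (* The gap of the unions lies in the union of the two gaps. *)
  have AD := field_setD fieldA CA AB; have AD' := field_setD fieldA CA' AB'.
  rewrite [e]splitr; apply: le_lt_trans (ltrD muCB muCB').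
  apply: le_trans (charge_leU fieldA chargemu AD AD').
  apply: (charge_le fieldA chargemu); [exact: field_setD|exact: field_setU|].
  by move=> x [[Cx|Cx] /= nBx]; [left|right]; split=> // Bx; apply: nBx; tauto.
Qed.

(** The approximant is [s] cut off by an inner approximation [B] of [E]. The extra error lives on
    the gap between [B] and [C], where [|f| <= |f - s| + M] and whose charge times [M] is below
    [e / 2]. *)
Lemma L1_indic f E : L1 f -> pj E -> L1 (fun x => f x * \1_E x).
Proof.
move=> /L1_P L1f /pjP pE; apply/L1_P => e e0; have e20 : 0 < e / 2 by rewrite divr_gt0.
have [s ss fs] := L1f _ e20; have [M M0 sM] := simple_function_bounded fieldA ss.
have [B [C [AB CA BE EC muCB]]] := pE _ (divr_gt0 e20 M0).
exists (fun x => s x * \1_B x).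
  by apply: (simple_comp2 fieldA *%R) => //; exact: simple_indic.
have AD := field_setD fieldA CA AB.
have fs' : upper_le (fun x => `|f x - s x|) (e / 2).
  by apply: upper_le_mono _ (lexx _) fs => x; rewrite normr_id.
have hM := upper_le_indic fieldA chargemu AD (ltW M0).
apply: upper_le_mono (upper_leD fieldA chargemu fs' hM) => [x|]; last first.
  rewrite (charge_setD fieldA chargemu) //; last exact: subset_trans EC.
  by move: muCB; rewrite ltr_pdivlMr// => muCB; lra.
rewrite /= [leRHS]ger0_norm; last by rewrite addr_ge0// mulr_ge0// ltW.
have [Bx|nBx] := pselect (B x).
  rewrite !indicE (mem_set Bx) (mem_set (BE _ Bx)).
  by rewrite !mulr1 lerDl mulr_ge0// ltW.
have [Ex|nEx] := pselect (E x).
  have CBx : (C `\` B) x by split=> //; exact: EC.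
  rewrite !indicE (memNset nBx) (mem_set Ex) (mem_set CBx) !mulr1.
  rewrite mulr0 subr0 -{1}[f x](subrK (s x)).
  by rewrite (le_trans (ler_normD _ _))// lerD2l.
rewrite !indicE (memNset nBx) (memNset nEx) !mulr0 subrr normr0.
by rewrite addr_ge0// mulr_ge0// ltW.
Qed.

(** Each term is a constant cut off by a set of the completion. *)
Lemma L1_pj_simple f : simple_function pj f -> L1 f.
Proof.
move=> [K [c [B [_ pB ->]]]]; apply: L1_sum => k; apply: L1_indic (pB k).
exact/L1_simple/simple_cst.
Qed.

Section levels.
Variable f : X -> R.
Let h y := outer_charge A mu [set x | y < f x].

Let h_mono : {homo h : x y / x <= y >-> y <= x}.
Proof.
by move=> x y xy; apply: (outer_charge_mono fieldA chargemu) => z; exact: le_lt_trans.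
Qed.

(** At a continuity point [y] of [h], the sets where [u N] exceeds [y + d / 2] or [y - d / 2],
    corrected by the exceptional set [D], enclose [{f > y}]. *)
Lemma hazily_cvg_levels (u : nat -> X -> R) : (forall n, simple (u n)) ->
  hazily_cvg A mu u f ->
  exists2 C : set R, countable C & forall y, ~ C y -> pj [set x | y < f x].
Proof.
move=> su /(hazily_cvgP fieldA chargemu) uf.
eexists; first exact: countable_jumps h_mono.
move=> y /contrapT hy; apply/pjP => e e0; have e20 : 0 < e / 2 by rewrite divr_gt0.
(* The charge of [D] enters the final estimate twice; the variation of [h] near [y] takes the other
   [e / 2]. *)
have e40 : 0 < e / 4 by rewrite divr_gt0.
have [d d0 hd] := hy _ e20; have d20 : 0 < d / 2 by rewrite divr_gt0.
have [N /(_ N (leqnn N)) [D [AD uD muD]]] := uf _ _ d20 e40.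
have {}uD x : ~ D x -> - (d / 2) <= u N x - f x <= d / 2.
  by move=> nDx; rewrite -ler_norml leNgt; apply/negP => /uD.
have AE (z : R) : A [set x | z < u N x].
  exact: (simple_preimage fieldA [set v | z < v] (su N)).
pose E z := [set x | z < u N x] `\` D.
have AED z : A (E z) by exact: field_setD.
exists (E (y + d / 2)), (E (y - d / 2) `|` D); split.
- exact: AED.
- exact: field_setU.
- by move=> x [/= ux /uD /andP[]]; lra.
- move=> x /= yx; have [Dx|nDx] := pselect (D x); first by right.
  by left; split=> //=; have /andP[] := uD _ nDx; lra.
(* Off [D], [u N] and [f] differ by at most [d / 2], so the enclosing sets compare with
   [{f > y - d}] and [{f > y + d}]. *)
have up : mu (E (y - d / 2)) <= h (y - d).
  apply: (outer_charge_ge fieldA chargemu) => F AF sF.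
  apply: (charge_le fieldA chargemu) => //.
  by move=> x [/= ux /uD /andP[]] *; apply: sF => /=; lra.
have low : h (y + d) <= mu (E (y + d / 2) `|` D).
  apply: (outer_charge_le fieldA chargemu); first exact: field_setU.
  move=> x /= yx; have [Dx|nDx] := pselect (D x); first by right.
  by left; split=> //=; have /andP[] := uD _ nDx; lra.
have := charge_leU fieldA chargemu (AED (y + d / 2)) AD.
have := charge_leU fieldA chargemu (AED (y - d / 2)) AD.
by lra.
Qed.

(** Weak inequalities serve for [f^-], since [{f^- > y}] is the complement of [{-y <= f}] when
    [y > 0]. At a continuity point of [h], [{y <= f}] is squeezed between [{y < f}] and [{z < f}]
    for an admissible [z] just below [y]. *)
Lemma pj_levels (C : set R) : countable C ->
  (forall y, ~ C y -> pj [set x | y < f x]) ->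
  exists2 C' : set R, countable C' & forall y, ~ C' y ->
    pj [set x | y < f x] /\ pj [set x | y <= f x].
Proof.
move=> cC pf; exists (C `|` [set y | ~ forall e : R, 0 < e ->
    exists2 d : R, 0 < d & h (y - d) - h (y + d) < e]).
  exact: countable_setU cC (countable_jumps h_mono).
move=> y /not_orP[Cy /contrapT hy]; split; first exact: pf.
apply/pjP => e e0; have e30 : 0 < e / 3 by rewrite divr_gt0.
have [d d0 hd] := hy _ e30.
have ydy : y - d < y by rewrite gtrBl.
have [z [ydz zy Cz]] := countable_avoid cC ydy.
have /pjP/(_ _ e30)[B [B' [AB AB' BS SB' muB]]] := pf _ Cy.
have /pjP/(_ _ e30)[D [D' [AD AD' DS SD' muD]]] := pf _ Cz.
exists B, D'; split=> //.
- by move=> x /BS /= /ltW.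
- by move=> x /= yx; apply: SD' => /=; exact: lt_le_trans yx.
(* Up to two gaps of [e / 3], [mu D' - mu B] is at most [h z - h y], itself below [e / 3]. *)
have h1 : h y <= mu B' by exact: (outer_charge_le fieldA chargemu).
have h2 : mu D <= h z.
  apply: (outer_charge_ge fieldA chargemu) => F AF sF.
  apply: (charge_le fieldA chargemu) => //.
  exact: subset_trans sF.
have h3 : h z <= h (y - d) by apply: h_mono; exact: ltW.
have h4 : h (y + d) <= h y by apply: h_mono; rewrite lerDl ltW.
by lra.
Qed.

End levels.

Lemma L1_levels f : L1 f ->
  exists2 C : set R, countable C & forall y, ~ C y -> pj [set x | y < f x].
Proof. by move=> [u [su uf _]]; exact: hazily_cvg_levels uf. Qed.

Lemma L1_tail f e : L1 f -> 0 < e -> exists y,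
  let g x := `|f x| * \1_[set x | y < `|f x|] x in
  [/\ 0 < y, L1 g & charge_integral A mu g < e].
Proof.
move=> L1f e0; have e30 : 0 < e / 3 by rewrite divr_gt0.
have L1n := L1_norm L1f; have [C cC pC] := L1_levels L1n.
have /L1_P/(_ _ e30)[s ss fs] := L1f.
have [M M0 sM] := simple_function_bounded fieldA ss.
have M12 : 2 * M < 2 * M + 1 by rewrite ltrDl.
(* [y] exceeds [2 * M] so that [|f| <= 2 * |f - s|] where [|f| > y], and avoids [C] so that this set
   lies in the completion. *)
have [y [My _ Cy]] := countable_avoid cC M12; exists y => g.
have L1g : L1 g by apply: L1_indic => //; exact: pC.
have g0 x : 0 <= g x by exact: mulr_ge0.
split=> //; first by apply: lt_trans My; rewrite mulr_gt0.
have [_ /(_ (2 * (e / 3))) gI] := charge_integral_upper_le L1g g0.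
apply: le_lt_trans (gI _) _; last by lra.
have fs2 := upper_leZ fieldA chargemu (ltr0Sn R 1) fs.
apply: upper_le_mono _ (lexx _) fs2 => x.
rewrite ger0_norm// /g normrM [`|2|]ger0_norm// indicE.
have [/set_mem /= yf|_] := boolP (x \in _); last by rewrite mulr0 mulr_ge0.
rewrite mulr1; have := ler_normD (f x - s x) (s x); rewrite subrK.
have := sM x; lra.
Qed.

End integrable.

(** * Staircase functions and nested dyadic levels *)

Section staircases.
Variable R : realType.

Lemma preimage_gt (X : Type) (p : X -> R) a :
  p @^-1` `]a, +oo[ = [set x | a < p x].
Proof. by apply/seteqP; split=> x /=; rewrite in_itv /= andbT. Qed.

Lemma preimage_oc (X : Type) (p : X -> R) a b :
  p @^-1` `]a, b] = [set x | a < p x] `\` [set x | b < p x].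
Proof.
apply/seteqP; split=> x /=; rewrite in_itv /=.
  by move=> /andP[-> pb]; split=> //; apply/negP; rewrite -leNgt.
by move=> [-> /negP]; rewrite -leNgt.
Qed.

(** At most one term is nonzero at [x]. Below the top level the error is the distance to the level
    beneath [p x], or [p x] itself under [y 1]; above it the error is [p x - y K <= p x]. *)
Lemma staircase_error (X : Type) (K : nat) (y : nat -> R) (p : X -> R) x d :
  (0 < K)%N -> (forall j, (0 < j < K)%N -> y j <= y j.+1 <= y j + d) ->
  0 <= y 1 <= d -> 0 <= p x ->
  `|p x - staircase K y p x| <= d + p x * \1_[set x | y K < p x] x.
Proof.
move=> K0 yS /andP[y10 y1d] px0.
pose T k := \sum_(1 <= j < k) y j * \1_(p @^-1` `]y j, y j.+1]) x.
(* Induction on the number of cells: while [p x] lies above [y k], no earlier cell contains it and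
   the partial sum is still zero. *)
have TK k : (0 < k <= K)%N ->
    [/\ 0 <= y k, p x <= y k -> 0 <= p x - T k <= d & y k < p x -> T k = 0].
  elim: k => // -[_ _|k IHk /= kK].
    rewrite /T big_geq// subr0; split=> // pxy.
    by rewrite px0 (le_trans pxy).
  have [yk0 Tk1 Tk2] := IHk (ltnW kK); have /andP[yS1 yS2] := yS k.+1 kK.
  rewrite /T big_nat_recr//= -/(T _) indicE.
  split; first exact: le_trans yS1.
    move=> pxy; have [pxk|pxk] := leP (p x) (y k.+1).
      rewrite memNset ?mulr0 ?addr0; first exact: Tk1.
      by rewrite preimage_oc => -[/=]; rewrite ltNge pxk.
    rewrite mem_set ?mulr1; last first.
      by rewrite preimage_oc; split=> //=; apply/negP; rewrite -leNgt.
    by rewrite Tk2// add0r subr_ge0 (ltW pxk) lerBlDl (le_trans pxy).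
  move=> pxy; rewrite Tk2 ?(le_lt_trans yS1)// memNset ?mulr0 ?addr0//.
  by rewrite preimage_oc => -[].
have [yK0 TK1 TK2] := TK K ltac:(by rewrite K0 leqnn).
rewrite /staircase -/(T K) preimage_gt !indicE.
have [pxy|pxy] := leP (p x) (y K).
  rewrite memNset ?mulr0 ?addr0; last by move=> /=; rewrite ltNge pxy.
  by have /andP[pT0 pTd] := TK1 pxy; rewrite ger0_norm.
rewrite mem_set// !mulr1 TK2// add0r ger0_norm; last by rewrite subr_ge0 ltW.
have d0 : 0 <= d := le_trans y10 y1d.
by lra.
Qed.

Lemma simple_staircase (X : Type) (F : set (set X)) (K : nat) (y : nat -> R)
    (p : X -> R) : is_field F -> (0 < K)%N ->
  (forall j, (0 < j <= K)%N -> F [set x | y j < p x]) ->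
  simple_function F (staircase K y p).
Proof.
move=> fieldF K0 Fy; apply: (simple_comp2 fieldF +%R).
  apply: simple_sum => // j; rewrite mem_index_iota => /andP[j0 jK].
  apply: (simple_comp fieldF ( *%R (y j))); apply: simple_indic => //.
  by rewrite preimage_oc; apply: field_setD => //; apply: Fy; rewrite ?j0 ?(ltnW jK).
apply: (simple_comp fieldF ( *%R (y K))); apply: simple_indic => //.
by rewrite preimage_gt; apply: Fy; rewrite K0 leqnn.
Qed.

Definition in_dyadic (n j : nat) (u : R) :=
  (j%:R - 1) / 2 ^+ n < u <= j%:R / 2 ^+ n.

(* A level of the coarser grid is kept by the half of its cell containing it. *)
Fixpoint dyadic_refine (c : nat -> nat -> R) (n j : nat) : R :=
  if n is n'.+1 then
    let u := dyadic_refine c n' (uphalf j) in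
    if in_dyadic n j u then u else c n j
  else c 0%N j.

(** Cell [j] of order [n] splits into cells [2j - 1] and [2j] of order [n + 1], both sent to [j] by
    [uphalf]. The half containing the old level keeps it; the other takes a fresh point outside
    [C]. *)
Lemma nested_levels (C : set R) : countable C -> exists y : nat -> nat -> R,
  [/\ forall n j, in_dyadic n j (y n j), forall n j, ~ C (y n j) &
      forall n j, (0 < j)%N ->
        exists2 i, (0 < i <= j.*2)%N & y n.+1 i = y n j].
Proof.
move=> cC; have /choice[c hc] : forall nj : nat * nat, exists u,
    in_dyadic nj.1 nj.2 u /\ ~ C u.
  move=> [n j]; have lt_cell : (j%:R - 1) / 2 ^+ n < j%:R / 2 ^+ n :> R.
    by rewrite ltr_pM2r ?invr_gt0 ?exprn_gt0// gtrBl.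
  have [u [u1 u2 Cu]] := countable_avoid cC lt_cell; exists u; split=> //=.
  by rewrite /in_dyadic u1 ltW.
pose y := dyadic_refine (fun n j => c (n, j)).
have y_cell n j : in_dyadic n j (y n j).
  rewrite /y; case: n => [|n] /=; first by case: (hc (0%N, j)).
  by case: ifP => // _; case: (hc (n.+1, j)).
exists y; split=> // [n j|n j j0].
  rewrite /y; elim: n j => [|n IHn] j /=; first by case: (hc (0%N, j)).
  by case: ifP => // _; case: (hc (n.+1, j)).
have yS i : y n.+1 i = if in_dyadic n.+1 i (y n (uphalf i))
  then y n (uphalf i) else c (n.+1, i) by [].
have n2 : 2 ^+ n.+1 = 2 * 2 ^+ n :> R by rewrite exprS.
have e2 : 0 < 2 ^+ n :> R by rewrite exprn_gt0.
have /andP[y1 y2] := y_cell n j.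
rewrite ltr_pdivrMr// in y1; rewrite ler_pdivlMr// in y2.
have [hi|lo] := ltP ((j.*2%:R - 1) / 2 ^+ n.+1) (y n j).
  exists j.*2; first by rewrite double_gt0 j0 leqnn.
  rewrite yS uphalf_double ifT// /in_dyadic hi /=.
  by rewrite ler_pdivlMr ?exprn_gt0// n2 -muln2 natrM; lra.
(* Lower half: [j] is rewritten as a successor, so that the cell [2j - 1] becomes [j.*2.+1]. *)
case: j j0 => // j _ in y1 y2 lo *.
exists j.*2.+1; first by rewrite doubleS leqnSn.
have -> : y n.+1 j.*2.+1 = _ := yS _.
have -> : uphalf j.*2.+1 = j.+1 by rewrite uphalfE /= doubleK.
rewrite ifT//.
move: lo; rewrite /in_dyadic ler_pdivlMr ?ltr_pdivrMr ?ler_pdivlMr ?exprn_gt0//.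
rewrite n2 doubleS -[j.*2.+2]addn2 -[j.*2.+1]addn1 !natrD -muln2 natrM.
by move: y1; rewrite -[j.+1]addn1 natrD => y1 lo; apply/andP; split; lra.
Qed.

End staircases.

(** * Seminorm convergence of staircases *)

Section staircase_integrals.
Variables (R : realType) (X : Type) (A : set (set X)) (mu : set X -> R).
Hypotheses (fieldA : is_field A) (chargemu : is_charge A mu).
Local Notation pj := (pj_completion A mu).

(** Once the top level exceeds [y0], the error is at most a constant [d] plus the tail of [|f|]
    above [y0]; the first contributes [d * mu setT], the second its integral. *)
Lemma staircase_upper_le (f p : X -> R) (y : nat -> nat -> R) :
  (forall x, 0 <= p x <= `|f x|) ->
  (forall n j, in_dyadic n j (y n j)) ->
  (forall e : R, 0 < e -> exists y0 : R,
     let g x := `|f x| * \1_[set x | y0 < `|f x|] x in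
     [/\ 0 < y0, L1 A mu g & charge_integral A mu g < e]) ->
  forall e : R, 0 < e -> exists2 N, (0 < N)%N & forall n, (N <= n)%N ->
    upper_le A mu (fun x => staircase (level_count n) (y n) p x - p x) e.
Proof.
move=> pf y_cell tail e e0; have e20 : 0 < e / 2 by rewrite divr_gt0.
have muT := charge_ge0 chargemu (field_setT fieldA).
have [y0 [y00 L1g Ig]] := tail _ e20.
have [|gI _] := charge_integral_upper_le fieldA chargemu L1g.
  by move=> x; exact: mulr_ge0.
(* The summand [1 + y0] forces the top level, which exceeds [n - 2^(-n)], above [y0]; the last
   summand gives [d * mu setT <= e / 2] because [n <= 2^n]. *)
pose M := 1 + y0 + 4 * mu setT / e.
exists (Num.truncn M).+1 => // n; rewrite -(ler_nat R) => Nn.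
have Mn : M < n%:R by apply: lt_le_trans Nn; exact: truncnS_gt.
have e2 : 0 < 2 ^+ n :> R by rewrite exprn_gt0.
have Me : 0 <= 4 * mu setT / e by rewrite divr_ge0 ?mulr_ge0// ltW.
have n0 : (0 < n)%N by rewrite -(ltr0n R) (le_lt_trans _ Mn)// /M; lra.
have K0 : (0 < level_count n)%N by rewrite muln_gt0 n0 expn_gt0.
have y_bounds j := andP (y_cell n j).
(* Levels in adjacent cells differ by less than two cell widths. *)
pose d : R := 2 / 2 ^+ n.
have step (j : nat) : j.+1%:R / 2 ^+ n = j%:R / 2 ^+ n + 1 / 2 ^+ n :> R.
  by rewrite -mulrDl -natr1.
have unit0 : 0 < 1 / 2 ^+ n :> R by rewrite divr_gt0.
have unit1 : 1 / 2 ^+ n <= 1 :> R by rewrite ler_pdivrMr// mul1r exprn_ege1 // ler1n.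
have dE : d = 1 / 2 ^+ n + 1 / 2 ^+ n by rewrite /d -mulrDl.
have dmu : d * mu setT <= e / 2.
  have : 4 * mu setT / e <= 2 ^+ n.
    apply: (@le_trans _ _ n%:R); first by move: Mn; rewrite /M; lra.
    by rewrite -natrX ler_nat ltnW// ltn_expl.
  rewrite ler_pdivrMr// /d mulrAC ler_pdivrMr//; lra.
have yK : y0 < y n (level_count n).
  have [yK _] := y_bounds (level_count n).
  apply: lt_trans yK; rewrite mulrBl natrM natrX mulfK ?gt_eqF//.
  by move: Mn; rewrite /M; lra.
have d0 : 0 <= d by rewrite dE; lra.
have := upper_leD fieldA chargemu (upper_le_cst fieldA chargemu d0) gI.
apply: upper_le_mono => [x|]; last by lra.
have /andP[px0 pxf] := pf x.
rewrite distrC [leRHS]ger0_norm; last by rewrite addr_ge0// mulr_ge0.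
apply: le_trans (staircase_error (d := d) K0 _ _ px0) _.
- move=> j _; have [] := y_bounds j; have [] := y_bounds j.+1.
  by rewrite !mulrBl step dE => *; apply/andP; split; lra.
- by have [] := y_bounds 1%N; rewrite subrr mul0r dE => *; apply/andP; split; lra.
rewrite lerD2l !indicE; have [/set_mem /= pyK|_] := boolP (x \in _); last first.
  by rewrite mulr0 mulr_ge0.
by rewrite mem_set ?mulr1//=; lra.
Qed.

(** For [n > 0] the [u n] are integrable, being simple over the completion, so the Cauchy condition
    on integrals is one on the seminorm. *)
Lemma L1_staircase_limit (u : nat -> X -> R) g : hazily_cvg A mu u g ->
  (forall n, (0 < n)%N -> simple_function pj (u n)) ->
  charge_integral A mu (fun x => `|u p.1 x - u p.2 x|)
    @[p --> (\oo, \oo)] --> (0 : R) ->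
  L1 A mu g.
Proof.
move=> ug su /cvg_pairs0P cauchy; apply: (L1_hazily_cvg fieldA chargemu ug) => e e0.
(* [N.+1] rather than [N], since [u 0] may fail to be simple. *)
have [N hN] := cauchy e e0; exists N.+1; split.
  by apply: L1_pj_simple => //; exact: su.
move=> n Nn; have L1u m : (N < m)%N -> L1 A mu (u m).
  by move=> Nm; apply: L1_pj_simple => //; apply: su; exact: leq_trans Nm.
have L1uu := L1_norm fieldA chargemu (L1D fieldA chargemu (L1u n Nn)
  (L1N fieldA chargemu (L1u N.+1 (leqnn _)))).
have [uI _] := charge_integral_upper_le fieldA chargemu L1uu (fun=> normr_ge0 _).
have /ltW lte := le_lt_trans (ler_norm _) (hN n N.+1 (ltnW Nn) (leqnSn N)).
by apply: upper_le_mono _ lte uI => x; rewrite normr_id.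
Qed.

(** Triangle inequality through [g]; the seminorm bound passes to the integral because the latter is
    the least such bound. *)
Lemma staircase_cauchy (u : nat -> X -> R) g N0 :
  (forall n, (N0 <= n)%N -> simple_function pj (u n)) ->
  (forall e : R, 0 < e -> exists2 N, (0 < N)%N & forall n, (N <= n)%N ->
    upper_le A mu (fun x => u n x - g x) e) ->
  charge_integral A mu (fun x => `|u p.1 x - u p.2 x|)
    @[p --> (\oo, \oo)] --> (0 : R).
Proof.
move=> su ug; apply/cvg_pairs0P => e e0; have e30 : 0 < e / 3 by rewrite divr_gt0.
have [N _ hN] := ug _ e30; exists (maxn N0 N) => m n.
rewrite !geq_max => /andP[/su sm /hN gm] /andP[/su sn /hN gn] /=.
have L1B := L1_norm fieldA chargemu (L1D fieldA chargemu
  (L1_pj_simple fieldA chargemu sm)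
  (L1N fieldA chargemu (L1_pj_simple fieldA chargemu sn))).
have [uI Iu] := charge_integral_upper_le fieldA chargemu L1B (fun=> normr_ge0 _).
have gn' : upper_le A mu (fun x => g x - u n x) (e / 3).
  by apply: upper_le_mono _ (lexx _) gn => x; rewrite distrC.
have mn : upper_le A mu (fun x => `|u m x - u n x|) (e / 3 + e / 3).
  apply: upper_le_mono _ (lexx _) (upper_leD fieldA chargemu gm gn') => x.
  by rewrite subrKA normr_id.
rewrite ger0_norm; last exact: upper_le_ge0 uI.
by apply: le_lt_trans (Iu _ mn) _; lra.
Qed.

End staircase_integrals.

Theorem theorem25 (R : realType) (X : Type) (A : set (set X))
    (mu : set X -> R) (fieldA : is_field A) (chargemu : is_charge A mu)
    (f : X -> R) :
  [<->
    (* 1 *)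
    L1 A mu f;
    (* 2 *)
    (exists2 C : set R, countable C &
       forall y : R, ~ C y -> pj_completion A mu (f @^-1` `]y, +oo[)) /\
    (forall e : R, 0 < e ->
       exists y : R,
         let g x := `|f x| * \1_((fun x => `|f x|) @^-1` `]y, +oo[) x in
         [/\ 0 < y, L1 A mu g & charge_integral A mu g < e]);
    (* 3 *)
    L0 A mu f /\
    exists (fp fm : nat -> X -> R) (y : nat -> nat -> R),
      let K := level_count in
      (forall n, (1 <= n)%N ->
         [/\ simple_function (pj_completion A mu) (fp n),
             simple_function (pj_completion A mu) (fm n),
             fp n = staircase (K n) (y n) (f^\+) &
             fm n = staircase (K n) (y n) (f^\-)]) /\
      (forall n j, (1 <= n)%N -> (1 <= j <= K n)%N ->
         [/\ (j%:R - 1) / 2 ^+ n < y n j <= j%:R / 2 ^+ n,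
             pj_completion A mu (f^\+ @^-1` `]y n j, +oo[) &
             pj_completion A mu (f^\- @^-1` `]y n j, +oo[)]) /\
      (forall n, (1 <= n)%N ->
         [set y n j | j in [set j | (1 <= j <= K n)%N]] `<=`
         [set y n.+1 j | j in [set j | (1 <= j <= K n.+1)%N]]) /\
      hazily_cvg A mu fp (f^\+) /\
      hazily_cvg A mu fm (f^\-) /\
      charge_integral A mu (fun x => `|fp p.1 x - fp p.2 x|)
        @[p --> (\oo, \oo)] --> (0 : R) /\
      charge_integral A mu (fun x => `|fm p.1 x - fm p.2 x|)
        @[p --> (\oo, \oo)] --> (0 : R)
  ].
Proof.
have pjF := pj_field fieldA chargemu.
have split_f : f = (fun x => f^\+ x + - f^\- x).
  apply/funext => x; rewrite /funrpos /funrneg; have [f0|f0] := leP 0 (f x).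
    by rewrite max_r ?subr0// oppr_le0.
  by rewrite max_l ?opprK ?add0r// oppr_ge0 ltW.
(* Used for (3 => 1), and within (2 => 3) to obtain membership of [f] in [L0]. *)
have back (fp fm : nat -> X -> R) : hazily_cvg A mu fp f^\+ ->
    hazily_cvg A mu fm f^\- ->
    (forall n, (0 < n)%N -> simple_function (pj_completion A mu) (fp n)) ->
    (forall n, (0 < n)%N -> simple_function (pj_completion A mu) (fm n)) ->
    charge_integral A mu (fun x => `|fp p.1 x - fp p.2 x|)
      @[p --> (\oo, \oo)] --> (0 : R) ->
    charge_integral A mu (fun x => `|fm p.1 x - fm p.2 x|)
      @[p --> (\oo, \oo)] --> (0 : R) ->
    L1 A mu f.
  move=> fpc fmc sp sm cp cm; rewrite split_f; apply: L1D => //.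
    exact: L1_staircase_limit fpc sp cp.
  by apply: L1N => //; exact: L1_staircase_limit fmc sm cm.
tfae.
- move=> L1f; split.
    have [C cC pC] := L1_levels fieldA chargemu L1f.
    by exists C => // y /pC; rewrite preimage_gt.
  move=> e e0; have [y hy] := L1_tail fieldA chargemu L1f e0.
  by exists y; rewrite preimage_gt.
- move=> [[C0 cC0 pC0] tail].
  have pC0' y : ~ C0 y -> pj_completion A mu [set x | y < f x].
    by move=> /pC0; rewrite preimage_gt.
  have [C cC pC] := pj_levels fieldA chargemu cC0 pC0'.
  (* Levels are to avoid both [C] and [-C]: the level [y] of [f^-] corresponds to the level [-y] of
     [f]. *)
  have cN : countable (-%R @` C) by exact: sub_countable (card_image_le _ _) cC.
  have [y [y_cell yC y_nest]] := nested_levels (countable_setU cC cN).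
  have {}tail : forall e : R, 0 < e -> exists y0 : R,
     let g x := `|f x| * \1_[set x | y0 < `|f x|] x in
     [/\ 0 < y0, L1 A mu g & charge_integral A mu g < e].
    by move=> e /tail[y0]; rewrite preimage_gt => hy0; exists y0.
  have fp_bound x : 0 <= f^\+ x <= `|f x|.
    by rewrite funrpos_ge0 /funrpos ge_max ler_norm normr_ge0.
  have fm_bound x : 0 <= f^\- x <= `|f x|.
    by rewrite funrneg_ge0 /funrneg ge_max -normrN ler_norm normr_ge0.
  have y_ge0 n j : (0 < j)%N -> 0 < y n j.
    move=> j0; have /andP[+ _] := y_cell n j; apply: le_lt_trans.
    by rewrite divr_ge0 ?exprn_ge0// subr_ge0 ler1n.
  have pos_level n j : (0 < j)%N ->
      pj_completion A mu [set x | y n j < f^\+ x].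
    move=> j0; have [|+ _] := pC (y n j); first by move=> Cy; apply: (yC n j); left.
    congr pj_completion; apply/seteqP; split=> x /=;
      by rewrite /funrpos lt_max (ltNge _ 0) (ltW (y_ge0 n j j0)) orbF.
  have neg_level n j : (0 < j)%N ->
      pj_completion A mu [set x | y n j < f^\- x].
    move=> j0; have [|_ pf] := pC (- y n j).
      by move=> Cy; apply: (yC n j); right; exists (- y n j); rewrite ?opprK.
    have -> : [set x | y n j < f^\- x] = ~` [set x | - y n j <= f x].
      apply/seteqP; split=> x /=;
        rewrite /funrneg lt_max (ltNge _ 0) (ltW (y_ge0 n j j0)) orbF ltrNr.
        by rewrite ltNge => /negP.
      by move=> /negP; rewrite -ltNge.
    exact: (field_setC pjF).
  pose fp n := staircase (level_count n) (y n) f^\+.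
  pose fm n := staircase (level_count n) (y n) f^\-.
  have K0 n : (0 < n)%N -> (0 < level_count n)%N.
    by move=> ?; rewrite muln_gt0 expn_gt0 andbT.
  have sp n : (0 < n)%N -> simple_function (pj_completion A mu) (fp n).
    by move=> /K0 n0; apply: simple_staircase => // j /andP[j0 _]; exact: pos_level.
  have sm n : (0 < n)%N -> simple_function (pj_completion A mu) (fm n).
    by move=> /K0 n0; apply: simple_staircase => // j /andP[j0 _]; exact: neg_level.
  have up := staircase_upper_le fieldA chargemu fp_bound y_cell tail.
  have um := staircase_upper_le fieldA chargemu fm_bound y_cell tail.
  have hp : hazily_cvg A mu fp f^\+.
    by apply: upper_le_hazily => // e /up[N _ hN]; exists N.
  have hm : hazily_cvg A mu fm f^\-.
    by apply: upper_le_hazily => // e /um[N _ hN]; exists N.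
  have cp := staircase_cauchy fieldA chargemu sp up.
  have cm := staircase_cauchy fieldA chargemu sm um.
  split; first by have [u [su uf _]] := back fp fm hp hm sp sm cp cm; exists u.
  exists fp, fm, y => K; split; first by move=> n n0; split=> //; [exact: sp|exact: sm].
  split=> [n j n0 /andP[j0 _]|].
    rewrite !preimage_gt; split; first exact: y_cell.
      exact: pos_level.
    exact: neg_level.
  split=> // n n0 _ [j /= /andP[j0 jK] <-].
  have [i /andP[i0 ij] yi] := y_nest n j j0; exists i => //=; rewrite i0 /=.
  (* [2 * j <= 2 * n * 2^n <= (n + 1) * 2^(n + 1)], so the retained level stays within the index
     range of the next stage. *)
  apply: (leq_trans ij); rewrite -muln2 /K /level_count expnSr mulnA leq_mul//.
  by apply: (leq_trans jK); rewrite /K /level_count leq_mul.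
- move=> [_ [fp [fm [y [sfy [_ [_ [hp [hm [cp cm]]]]]]]]]].
  by apply: back hp hm _ _ cp cm => n n0; have [] := sfy n n0.
Qed.
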